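(* Consider a Markov decision process with finite state space $\mathcal{S}$, finite action set $\mathcal{A}$, transition probabilities $p(\cdot\mid s,a)$, rewards $r:\mathcal{S}\times\mathcal{A}\to[0,1]$ with $r_{\max}=\max_{s,a}r(s,a)$, and discount factor $\gamma\in(0,1)$. Let $Q^*$ be the unique fixed point of $\mathcal{T}Q(s,a)=\sum_{s'}p(s'\mid s,a)\bigl(r(s,a)+\gamma\max_{a'}Q(s',a')\bigr)$. Consider the algorithm: given $Q^0$ with $\|Q^0\|_\infty\le\frac{r_{\max}}{1-\gamma}$ and a number of iterations $N$, for $n=1,\dots,N$ set $k_n=\lceil n^2\gamma^{N-n}\rceil$, for every $(s,a)$ draw independent samples $s_1(s,a),\dots,s_{k_n}(s,a)\sim p(\cdot\mid s,a)$, compute $$\hat{\mathcal{T}}_nQ^{n-1}(s,a)=r(s,a)+\gamma\frac{1}{k_n}\sum_{i=1}^{k_n}\max_{a'\in\mathcal{A}}Q^{n-1}(s_i(s,a),a'),$$ and set $Q^n=(1-\beta_n)Q^0+\beta_n\hat{\mathcal{T}}_nQ^{n-1}$ with $\beta_n=\frac{n}{n+1}$. Then, given $\varepsilon>0$, the algorithm produces an iterate $Q^N$ with $\mathbb{E}(\|Q^N-Q^*\|_\infty)\le\varepsilon$ using at most $\tilde O\!\left(\frac{|\mathcal{S}\times\mathcal{A}|\,r_{\max}^2}{\varepsilon^2(1-\gamma)^5}\right)$ queries to the stochastic oracle.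
   Context: A query is one draw of a next state $s'\sim p(\cdot\mid s,a)$ for one pair $(s,a)$. $\tilde O$ denotes big-$O$ ignoring logarithmic factors. *)

(* Defs.v *)
From HB Require Import structures.
From mathcomp Require Import all_boot all_order all_algebra.
From mathcomp Require Import all_classical all_reals all_analysis.
Set Implicit Arguments. Unset Strict Implicit. Unset Printing Implicit Defensive.
Import Order.TTheory GRing.Theory Num.Theory.
Local Open Scope ring_scope.

Section MDP.
Variables (R : realType) (S A : finType) (a0 : A).
(* transition kernel p(s' | s, a) = p s a s', reward r, discount gamma *)
Variables (p : S -> A -> S -> R) (r : S -> A -> R) (gamma : R).

(* max_{a'} Q(s,a') ; a0 only witnesses that A is nonempty *)
Definition vmax (Q : S -> A -> R) (s : S) : R :=
  \big[Num.max/Q s a0]_(a : A) Q s a.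

Definition supnorm (Q : S -> A -> R) : R :=
  \big[Num.max/0]_(sa : (S * A)%type) `|Q sa.1 sa.2|.

Definition rmax : R := \big[Num.max/0]_(sa : (S * A)%type) r sa.1 sa.2.

Definition bellman (Q : S -> A -> R) : S -> A -> R :=
  fun s a => \sum_(s' : S) p s a s' * (r s a + gamma * vmax Q s').

Definition kn (N n : nat) : nat := `|Num.ceil (n%:R ^+ 2 * gamma ^+ (N - n))|%N.

Definition samples (k : nat) := {ffun (S * A)%type -> {ffun 'I_k -> S}}.

(* probability of a sample configuration (independent draws s_i(s,a) ~ p(.|s,a)) *)
Definition sprob (k : nat) (w : samples k) : R :=
  \prod_(sa : (S * A)%type) \prod_(i < k) p sa.1 sa.2 (w sa i).

Definition emp_bellman (k : nat) (w : samples k) (Q : S -> A -> R) : S -> A -> R :=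
  fun s a => r s a + gamma * (k%:R^-1 * \sum_(i < k) vmax Q (w (s, a) i)).

Definition alg_step (Q0 : S -> A -> R) (n k : nat) (w : samples k)
    (Q : S -> A -> R) : S -> A -> R :=
  let beta := n%:R / (n%:R + 1) in
  fun s a => (1 - beta) * Q0 s a + beta * emp_bellman w Q s a.

(* expected final error E ||Q^N - Q*||, computed exactly as a finite expectation:
   exp_err N Qstar Q0 m n Q = expectation of ||Q^N - Q*|| given Q^{n-1} = Q
   with m iterations n, ..., n+m-1 = N remaining *)
Fixpoint exp_err (N : nat) (Qstar Q0 : S -> A -> R) (m n : nat) (Q : S -> A -> R)
  : R :=
  match m with
  | 0 => supnorm (fun s a => Q s a - Qstar s a)
  | m'.+1 => \sum_(w : samples (kn N n))
               sprob w * exp_err N Qstar Q0 m' n.+1 (alg_step Q0 n w Q)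
  end.

Definition expected_error (N : nat) (Qstar Q0 : S -> A -> R) : R :=
  exp_err N Qstar Q0 N 1 Q0.

Definition num_queries (N : nat) : nat :=
  \sum_(1 <= n < N.+1) #|{: S * A}| * kn N n.

End MDP.

(* Main.v *)
Require Import Defs.
From HB Require Import structures.
From mathcomp Require Import all_boot all_order all_algebra.
From mathcomp Require Import all_classical all_reals all_analysis.
From mathcomp Require Import ring lra.
Import Order.TTheory GRing.Theory Num.Theory.
Local Open Scope ring_scope.
Set Implicit Arguments.
Unset Strict Implicit.

(* Let [Lambda] be the logarithm in the query bound and [D = rmax / (1 - gamma)],
   which bounds [Q*] and every iterate.  With [U_n] the sampling error of step [n],
   [a_n = (n + 1) E |Q^n - Q*|] satisfies
   [a_n <= |Q^0 - Q*| + gamma a_(n-1) + n E |U_n|].  A sub-Gaussian maximal inequality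
   gives [E |U_n| <= 16 D Lambda / sqrt k_n], and [k_n >= n^2 gamma^(N-n)] turns
   [gamma^(N-n) n E |U_n|] into [16 D Lambda sqrt(gamma)^(N-n)], which is summable:
   [a_N <= 72 D Lambda / (1 - gamma)].  Taking [N] of order
   [rmax Lambda / (eps (1 - gamma)^2)] gives error at most [eps], and the number of
   samples per pair is at most [2 N^2 / (1 - gamma)]. *)

(** * Exponential moments of bounded centred variables *)

Section ExponentialMoments.
Variable R : realType.
Implicit Types x B l : R.

(** Inverting [1 - x <= expR (- x)] gives [expR x <= 1 / (1 - x)], and [(1 - x) * (1 + x + 2 * x ^+
    2) = 1 + x ^+ 2 * (1 - 2 * x)] is at least 1. *)
Lemma expR_le_quadratic x : x <= 1 / 2 -> expR x <= 1 + x + 2 * x ^+ 2.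
Proof.
move=> hx; have h := expR_ge1Dx (- x).
have x1 : 0 < 1 - x by lra.
have -> : expR x = (expR (- x))^-1 by rewrite expRN invrK.
apply: (@le_trans _ _ (1 - x)^-1); first by rewrite lef_pV2 ?posrE ?expR_gt0.
rewrite -[leLHS]mul1r ler_pdivrMr //.
have := sqr_ge0 x; nra.
Qed.

Lemma expR_half_le2 : expR (1 / 2) <= 2 :> R.
Proof. by apply: (le_trans (expR_le_quadratic (lexx _))); lra. Qed.

Lemma expR1_le4 : expR 1 <= 4 :> R.
Proof.
have -> : expR 1 = expR (1 / 2) * expR (1 / 2) :> R.
  by rewrite -expRD; congr expR; field.
have := expR_ge0 (1 / 2 : R); have := expR_half_le2; nra.
Qed.

(** Second-order expansion: centring removes the linear term, and [1 + y <= expR y] turns the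
    remainder into a sub-Gaussian bound. *)
Lemma expR_moment_le (S : finType) (p X : S -> R) B l :
  (forall s, 0 <= p s) -> \sum_s p s = 1 -> \sum_s p s * X s = 0 ->
  (forall s, `|X s| <= B) -> `|l| * B <= 1 / 2 ->
  \sum_s p s * expR (l * X s) <= expR (2 * (l * B) ^+ 2).
Proof.
move=> p0 p1 pX XB lB.
apply: (@le_trans _ _ (\sum_s (p s + l * (p s * X s) + p s * (2 * (l * B) ^+ 2)))).
  apply: ler_sum => s _.
  have lX : `|l * X s| <= `|l| * B by rewrite normrM ler_wpM2l.
  have lX2 : (l * X s) ^+ 2 <= (l * B) ^+ 2.
    rewrite -(real_normK (num_real (l * X s))) -(real_normK (num_real (l * B))).
    rewrite lerXn2r ?nnegrE // normrM [leRHS]normrM ler_wpM2l //.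
    by rewrite (le_trans (XB s)) // ler_norm.
  have h : expR (l * X s) <= 1 + l * X s + 2 * (l * B) ^+ 2.
    apply: (le_trans (expR_le_quadratic _)); last by lra.
    by rewrite (le_trans (ler_norm _)) // (le_trans lX).
  have := ler_wpM2l (p0 s) h; nra.
rewrite !big_split /= -mulr_sumr pX -mulr_suml p1 mulr0 addr0 mul1r.
exact: expR_ge1Dx.
Qed.

End ExponentialMoments.

(** * Independent samples and a maximal inequality *)

Section ProductMeasure.
Variables (R : realType) (J S : finType) (k : nat).
Variable p : J -> S -> R.
Hypothesis p0 : forall j s, 0 <= p j s.
Hypothesis p1 : forall j, \sum_s p j s = 1.

Let W := {ffun J -> {ffun 'I_k -> S}}.
Let P (w : W) : R := \prod_j \prod_(i < k) p j (w j i).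

(** Distributivity is applied once over [J] and once over the [k] draws. *)
Lemma sum_prod_samples (F : J -> S -> R) :
  \sum_(w : W) \prod_j \prod_(i < k) F j (w j i) = \prod_j (\sum_s F j s) ^+ k.
Proof.
rewrite -(bigA_distr_bigA (fun j (v : {ffun 'I_k -> S}) => \prod_(i < k) F j (v i))).
apply: eq_bigr => j _.
by rewrite -(bigA_distr_bigA (fun (i : 'I_k) s => F j s)) prodr_const card_ord.
Qed.

Lemma samples_prob_ge0 (w : W) : 0 <= P w.
Proof. by apply: prodr_ge0 => j _; apply: prodr_ge0. Qed.

Lemma samples_prob_sum1 : \sum_(w : W) P w = 1.
Proof.
rewrite sum_prod_samples big1 // => j _.
by rewrite p1 expr1n.
Qed.

(** Independence: the exponential is absorbed into the weights of the draws at [j0], while all other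
    draws sum to 1. *)
Lemma samples_moment (j0 : J) (f : S -> R) :
  \sum_(w : W) P w * expR (\sum_(i < k) f (w j0 i)) =
  (\sum_s p j0 s * expR (f s)) ^+ k.
Proof.
pose F j s := p j s * (if j == j0 then expR (f s) else 1).
transitivity (\sum_(w : W) \prod_j \prod_(i < k) F j (w j i)).
  apply: eq_bigr => w _; rewrite expR_sum /P (bigD1 j0) //= [RHS](bigD1 j0) //=.
  rewrite mulrAC -big_split /=; congr (_ * _).
    by apply: eq_bigr => i _; rewrite /F eqxx.
  apply: eq_bigr => j /negbTE nj; apply: eq_bigr => i _.
  by rewrite /F nj mulr1.
rewrite sum_prod_samples (bigD1 j0) //= [X in _ * X]big1 ?mulr1.
  by rewrite /F eqxx.
move=> j /negbTE nj; rewrite /F nj.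
by under eq_bigr do rewrite mulr1; rewrite p1 expr1n.
Qed.

(* Bounding [u <= L + exp (u - L)] for [u = l * max_j |Y_j|] and the exponential
   of a maximum by a sum of exponentials; [l = 1 / (2 B sqrt k)] makes each
   exponential moment at most [exp (1/2)]. *)
Lemma maximal_inequality (X : J -> S -> R) (B L : R) :
  (0 < k)%N -> 0 < B -> 1 <= L -> 2 * #|J|%:R <= expR (2 * L) ->
  (forall j, \sum_s p j s * X j s = 0) ->
  (forall j s, `|X j s| <= B) ->
  \sum_(w : W) P w * \big[Num.max/0]_j `|\sum_(i < k) X j (w j i)|
    <= 8 * B * Num.sqrt k%:R * L.
Proof.
move=> k0 B0 L1 JL pX XB.
pose q : R := Num.sqrt k%:R.
have q0 : 0 < q by rewrite sqrtr_gt0 ltr0n.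
have q2 : q ^+ 2 = k%:R by rewrite sqr_sqrtr.
have q1 : 1 <= q by rewrite -[leLHS]sqrtr1 ler_wsqrtr // ler1n.
pose l := (2 * B * q)^-1.
have l0 : 0 < l by rewrite invr_gt0 !mulr_gt0.
have lB : l * B = (2 * q)^-1 by rewrite /l; field; lra.
have lB12 : l * B <= 1 / 2.
  by rewrite lB -[leLHS]mul1r ler_pdivrMr; lra.
(* The signs [e = 1] and [e = -1] together control the absolute value. *)
have mom (e : R) j : `|e| = 1 ->
    \sum_(w : W) P w * expR (e * l * \sum_(i < k) X j (w j i)) <= 2.
  move=> e1; under eq_bigr do rewrite mulr_sumr.
  rewrite (samples_moment j (fun s => e * l * X j s)).
  have el : `|e * l| = l by rewrite normrM e1 mul1r gtr0_norm.
  have h : \sum_s p j s * expR (e * l * X j s) <= expR (2 * (e * l * B) ^+ 2).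
    by apply: expR_moment_le => //; rewrite el.
  apply: (le_trans _ (expR_half_le2 R)).
  apply: (@le_trans _ _ (expR (2 * (e * l * B) ^+ 2) ^+ k)).
    rewrite lerXn2r ?nnegrE ?expR_ge0 //.
    by apply: sumr_ge0 => s _; rewrite mulr_ge0 ?expR_ge0.
  rewrite -expRM_natr ler_expR.
  have -> : (e * l * B) ^+ 2 = (l * B) ^+ 2.
    by rewrite -[in LHS]mulrA exprMn -(real_normK (num_real e)) e1 expr1n mul1r.
  rewrite lB -q2 (_ : _ * q ^+ 2 = 1 / 2) //.
  by field; lra.
pose Y (w : W) j := \sum_(i < k) X j (w j i).
pose Z (w : W) := \sum_j (expR (1 * l * Y w j) + expR (-1 * l * Y w j)).
(* The shift is [2 * L]; nonnegativity of the right-hand side also covers the default value 0 of the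
   maximum. *)
have Mle w : l * \big[Num.max/0]_j `|Y w j| <= 2 * L + expR (- (2 * L)) * Z w.
  have Z0 : 0 <= expR (- (2 * L)) * Z w.
    by rewrite mulr_ge0 ?expR_ge0 // sumr_ge0 // => j _; rewrite addr_ge0 ?expR_ge0.
  rewrite -ler_pdivlMl //; apply: bigmax_le => [|j _].
    by apply: mulr_ge0; [rewrite invr_ge0 ltW|lra].
  rewrite ler_pdivlMl //.
  have h1 : l * `|Y w j| - 2 * L <= expR (l * `|Y w j| - 2 * L).
    by have := expR_ge1Dx (l * `|Y w j| - 2 * L); lra.
  have h2 : expR (l * `|Y w j|) <= Z w.
    rewrite /Z (bigD1 j) //=.
    have : 0 <= \sum_(i | i != j) (expR (1 * l * Y w i) + expR (-1 * l * Y w i)).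
      by apply: sumr_ge0 => i _; rewrite addr_ge0 ?expR_ge0.
    have := expR_ge0 (1 * l * Y w j); have := expR_ge0 (-1 * l * Y w j).
    case: (ger0P (Y w j)) => _; first by rewrite mul1r; lra.
    by rewrite (_ : l * - Y w j = -1 * l * Y w j); [lra|ring].
  rewrite expRD in h1.
  have := ler_wpM2l (expR_ge0 (- (2 * L))) h2; lra.
have EZ : \sum_(w : W) P w * Z w <= #|J|%:R * 4.
  have -> : \sum_(w : W) P w * Z w =
      \sum_j (\sum_(w : W) P w * expR (1 * l * Y w j)
            + \sum_(w : W) P w * expR (-1 * l * Y w j)).
    under eq_bigr do rewrite mulr_sumr.
    rewrite exchange_big; apply: eq_bigr => j _ /=.
    by rewrite -big_split; apply: eq_bigr => w _; rewrite mulrDr.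
  rewrite mulr_natl -sumr_const; apply: ler_sum => j _.
  have := mom 1 j (normr1 _); have := mom (-1) j.
  rewrite normrN normr1 => /(_ erefl); rewrite -/(Y _ _); lra.
have EM : l * (\sum_(w : W) P w * \big[Num.max/0]_j `|Y w j|) <= 4 * L.
  rewrite mulr_sumr.
  apply: (@le_trans _ _ (\sum_(w : W) (P w * (2 * L) + expR (- (2 * L)) * (P w * Z w)))).
    apply: ler_sum => w _.
    by have := ler_wpM2l (samples_prob_ge0 w) (Mle w); lra.
  rewrite big_split /= -mulr_suml samples_prob_sum1 -mulr_sumr.
  (* The exponential part contributes at most [4 * #|J| * expR (- (2 * L)) <= 2 <= 2 * L], whence
     [4 * L] in total. *)
  have := ler_wpM2l (expR_ge0 (- (2 * L))) EZ.
  have := ler_wpM2l (expR_ge0 (- (2 * L))) JL.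
  rewrite -expRD addNr expR0; lra.
rewrite mulrC -ler_pdivlMr // /l invrK in EM.
by rewrite (_ : _ * L = 4 * L * (2 * B * q)) //; rewrite /q; ring.
Qed.

End ProductMeasure.

(** * Sup norm, maximum over actions and averages *)

Section Bellman.
Variables (R : realType) (S A : finType) (a0 : A).
Implicit Types (Q : S -> A -> R) (b : R).

Lemma supnorm_ge0 Q : 0 <= supnorm Q.
Proof. exact: bigmax_ge_id. Qed.

Lemma le_supnorm Q s a : `|Q s a| <= supnorm Q.
Proof. exact: (le_bigmax 0 (fun sa : S * A => `|Q sa.1 sa.2|) (s, a)). Qed.

Lemma supnorm_le Q b : 0 <= b -> (forall s a, `|Q s a| <= b) -> supnorm Q <= b.
Proof. by move=> b0 Qb; apply: bigmax_le => // sa _. Qed.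

Lemma vmax_le Q s b : (forall a, Q s a <= b) -> vmax a0 Q s <= b.
Proof. by move=> Qb; apply: bigmax_le. Qed.

Lemma le_vmax Q s a : Q s a <= vmax a0 Q s.
Proof. exact: (le_bigmax _ (Q s)). Qed.

(** Each [Q s a] is at most [vmax a0 Q' s + b], and symmetrically; this is the source of the
    contraction. *)
Lemma vmax_dist_le Q Q' s b :
  (forall a, `|Q s a - Q' s a| <= b) -> `|vmax a0 Q s - vmax a0 Q' s| <= b.
Proof.
move=> QQ'; rewrite ler_norml; apply/andP; split.
  rewrite lerBrDl addrC -lerBrDl; apply: vmax_le => a.
  by have := QQ' a; rewrite ler_norml => /andP[]; have := le_vmax Q s a; lra.
rewrite lerBlDr; apply: vmax_le => a.
by have := QQ' a; rewrite ler_norml => /andP[_]; have := le_vmax Q' s a; lra.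
Qed.

Lemma norm_vmax_le Q s b : (forall a, `|Q s a| <= b) -> `|vmax a0 Q s| <= b.
Proof.
move=> Qb; rewrite ler_norml; apply/andP; split.
  by rewrite (le_trans _ (le_vmax Q s a0)) //; have := Qb a0; rewrite ler_norml => /andP[].
by apply: vmax_le => a; rewrite (le_trans (ler_norm _)).
Qed.

Lemma norm_mean_le (q f : S -> R) b :
  (forall s, 0 <= q s) -> \sum_s q s = 1 -> (forall s, `|f s| <= b) ->
  `|\sum_s q s * f s| <= b.
Proof.
move=> q0 q1 fb; apply: (le_trans (ler_norm_sum _ _ _)).
rewrite -[leRHS]mul1r -q1 mulr_suml; apply: ler_sum => s _.
by rewrite normrM ger0_norm // ler_wpM2l.
Qed.

Lemma rmax_ge0 (r : S -> A -> R) : 0 <= rmax r.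
Proof. exact: bigmax_ge_id. Qed.

Lemma le_rmax (r : S -> A -> R) s a : r s a <= rmax r.
Proof. exact: (le_bigmax 0 (fun sa : S * A => r sa.1 sa.2) (s, a)). Qed.

End Bellman.

(** * Sample sizes and the total number of queries *)

Section SampleSizes.
Variables (R : realType) (gamma : R).
Hypotheses (g_gt0 : 0 < gamma) (g_lt1 : gamma < 1).

Lemma kn_bounds N n :
  n%:R ^+ 2 * gamma ^+ (N - n) <= (kn gamma N n)%:R <= n%:R ^+ 2 * gamma ^+ (N - n) + 1.
Proof.
set x := n%:R ^+ 2 * gamma ^+ (N - n).
have x0 : 0 <= x by apply: mulr_ge0; [exact: sqr_ge0|rewrite exprn_ge0 // ltW].
have c0 : 0 <= Num.ceil x by rewrite ceil_ge0; lra.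
have -> : (kn gamma N n)%:R = (Num.ceil x)%:~R :> R.
  by rewrite /kn -/x pmulrn abszE ger0_norm.
have /andP[h ->] := ceil_itv x.
by rewrite rmorphB /= in h; apply: ltW; lra.
Qed.

Lemma kn_gt0 N n : (0 < n)%N -> (0 < kn gamma N n)%N.
Proof.
move=> n0; have /andP[h _] := kn_bounds N n.
rewrite -(ltr0n R) (lt_le_trans _ h) // mulr_gt0 ?exprn_gt0 ?ltr0n //.
Qed.

(** The sums obey [s_(N+1) = gamma * s_N + 1], a recursion with fixed point [1 / (1 - gamma)]. *)
Lemma sum_geometric_tail_le N :
  \sum_(1 <= n < N.+1) gamma ^+ (N - n) <= (1 - gamma)^-1.
Proof.
have g1 : 0 < 1 - gamma by rewrite subr_gt0.
elim: N => [|N IH]; first by rewrite big_nil invr_ge0 ltW.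
rewrite big_nat_recr //= subnn expr0.
have -> : \sum_(1 <= n < N.+1) gamma ^+ (N.+1 - n) =
          gamma * \sum_(1 <= n < N.+1) gamma ^+ (N - n).
  by rewrite mulr_sumr; apply: eq_big_nat => n /andP[_ nN]; rewrite subSn // exprS.
have -> : (1 - gamma)^-1 = gamma * (1 - gamma)^-1 + 1 by field; lra.
by rewrite lerD2r ler_wpM2l // ltW.
Qed.

(** Rounding up costs at most one sample per step, so [N] in total, which
    [N <= N ^+ 2 / (1 - gamma)] absorbs into the factor 2. *)
Lemma num_queries_le (S A : finType) N :
  (num_queries S A gamma N)%:R <= #|{: S * A}|%:R * (2 * N%:R ^+ 2 / (1 - gamma)).
Proof.
have g1 : 0 < 1 - gamma by rewrite subr_gt0.
rewrite /num_queries -big_distrr /= natrM ler_wpM2l // natr_sum.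
apply: (@le_trans _ _ (\sum_(1 <= n < N.+1) (N%:R ^+ 2 * gamma ^+ (N - n) + 1))).
  apply: ler_sum_nat => n /andP[_ nN]; have /andP[_ h] := kn_bounds N n.
  rewrite (le_trans h) // lerD2r ler_wpM2r ?exprn_ge0 ?(ltW g_gt0) //.
  by rewrite lerXn2r ?nnegrE // ler_nat.
rewrite big_split /= -mulr_sumr sumr_const_nat subSS subn0.
have h := ler_wpM2l (sqr_ge0 N%:R) (sum_geometric_tail_le N).
have NN : N%:R <= N%:R ^+ 2 / (1 - gamma) :> R.
  rewrite ler_pdivlMr //; apply: (@le_trans _ _ N%:R).
    by rewrite -[leRHS]mulr1 ler_wpM2l // lerBlDr lerDl ltW.
  by rewrite -natrX ler_nat; case: (N) => // M; rewrite leq_pmulr.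
rewrite -mulrA; lra.
Qed.

End SampleSizes.

(** * One step of the iteration anchored at [Q0] *)

Section HalpernIteration.
Variables (R : realType) (S A : finType) (a0 : A).
Variables (p : S -> A -> S -> R) (r : S -> A -> R) (gamma : R).
Variables (Qstar Q0 : S -> A -> R).
Hypothesis p0 : forall s a s', 0 <= p s a s'.
Hypothesis p1 : forall s a, \sum_s' p s a s' = 1.
Hypothesis r0 : forall s a, 0 <= r s a.
Hypotheses (g_gt0 : 0 < gamma) (g_lt1 : gamma < 1).
Hypothesis Qstar_fix : forall s a, Qstar s a = bellman a0 p r gamma Qstar s a.

Let D : R := rmax r / (1 - gamma).
Hypothesis Q0D : supnorm Q0 <= D.

Let dist Q : R := supnorm (fun s a => Q s a - Qstar s a).

Lemma discounted_bound_ge0 : 0 <= D.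
Proof. by rewrite divr_ge0 ?rmax_ge0 // subr_ge0 ltW. Qed.

Lemma rmaxE : rmax r = (1 - gamma) * D.
Proof. by rewrite /D mulrC divfK // subr_eq0 eq_sym lt_eqF. Qed.

Lemma norm_reward_le s a : `|r s a| <= rmax r.
Proof. by rewrite ger0_norm // le_rmax. Qed.

Lemma bellmanE Q s a :
  bellman a0 p r gamma Q s a = r s a + gamma * \sum_s' p s a s' * vmax a0 Q s'.
Proof.
rewrite /bellman; under eq_bigr do rewrite mulrDr mulrCA.
by rewrite big_split /= -mulr_suml p1 mul1r -mulr_sumr.
Qed.

(** The fixed-point equation bounds the norm by [rmax r] plus [gamma] times itself. *)
Lemma supnorm_fixpoint_le : supnorm Qstar <= D.
Proof.
have g1 : 0 < 1 - gamma by rewrite subr_gt0.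
have h : supnorm Qstar <= rmax r + gamma * supnorm Qstar.
  apply: supnorm_le => [|s a].
    by rewrite addr_ge0 ?rmax_ge0 // mulr_ge0 ?supnorm_ge0 // ltW.
  rewrite Qstar_fix bellmanE (le_trans (ler_normD _ _)) // lerD ?norm_reward_le //.
  rewrite normrM gtr0_norm // ler_wpM2l ?(ltW g_gt0) //; apply: norm_mean_le => // s'.
  by apply: norm_vmax_le => a'; exact: le_supnorm.
by rewrite /D ler_pdivlMr //; lra.
Qed.

Lemma dist_le Q : supnorm Q <= D -> dist Q <= 2 * D.
Proof.
move=> QD; have D0 := discounted_bound_ge0.
apply: supnorm_le => [|s a]; first by lra.
have := ler_normB (Q s a) (Qstar s a).
have := le_supnorm Q s a; have := le_supnorm Qstar s a.
have := supnorm_fixpoint_le; lra.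
Qed.

Lemma norm_average_le (k : nat) (f : 'I_k -> R) b :
  (0 < k)%N -> (forall i, `|f i| <= b) -> `|k%:R^-1 * \sum_(i < k) f i| <= b.
Proof.
move=> k0 fb; rewrite normrM ger0_norm ?invr_ge0 // ler_pdivrMl ?ltr0n //.
apply: (le_trans (ler_norm_sum _ _ _)).
by rewrite mulr_natl -[X in _ *+ X]card_ord -sumr_const; exact: ler_sum.
Qed.

(** A step is a convex combination of [Q0] and an empirical Bellman image, which stays within [D]
    because [rmax r + gamma * D = D]. *)
Lemma alg_step_supnorm_le n k (w : samples S A k) Q :
  (0 < k)%N -> supnorm Q <= D -> supnorm (alg_step a0 r gamma Q0 n w Q) <= D.
Proof.
move=> k0 QD; apply: supnorm_le => [|s a]; first exact: discounted_bound_ge0.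
rewrite /alg_step; set beta := n%:R / (n%:R + 1).
have n1 : 0 < n%:R + 1 :> R by rewrite ltr_wpDl.
have b0 : 0 <= beta by rewrite divr_ge0 // ltW.
have b1 : 0 <= 1 - beta.
  by rewrite subr_ge0 ler_pdivrMr // mul1r lerDl.
have hE : `|emp_bellman a0 r gamma w Q s a| <= D.
  rewrite (le_trans (ler_normD _ _)) //.
  have -> : D = rmax r + gamma * D by rewrite rmaxE; ring.
  rewrite lerD ?norm_reward_le // normrM gtr0_norm // ler_wpM2l ?(ltW g_gt0) //.
  apply: norm_average_le => // i; apply: norm_vmax_le => a'.
  exact: le_trans (le_supnorm _ _ _) QD.
have hQ : `|Q0 s a| <= D by exact: le_trans (le_supnorm _ _ _) Q0D.
rewrite (le_trans (ler_normD _ _)) // 2!normrM (ger0_norm b0) (ger0_norm b1).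
have := ler_wpM2l b0 hE; have := ler_wpM2l b1 hQ; lra.
Qed.

Definition sampling_deviation Q (sa : S * A) s' : R :=
  vmax a0 Q s' - \sum_t p sa.1 sa.2 t * vmax a0 Q t.

(** The sums are left unnormalised to match the maximal inequality; the factor [1 / k] appears where
    the noise is used. *)
Definition sampling_noise k (w : samples S A k) Q : R :=
  \big[Num.max/0]_sa `|\sum_(i < k) sampling_deviation Q sa (w sa i)|.

(** Since [1 - beta = 1 / (n + 1)], scaling by [n + 1] gives the anchor error weight 1 and the
    Bellman error weight [n]; the latter splits into a contraction and noise. The bound is
    pathwise. *)
Lemma alg_step_dist_le n k (w : samples S A k) Q : (0 < k)%N ->
  (n%:R + 1) * dist (alg_step a0 r gamma Q0 n w Q) <=
  dist Q0 + n%:R * (gamma * dist Q + k%:R^-1 * sampling_noise w Q).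
Proof.
move=> k0.
have n1 : 0 < n%:R + 1 :> R by rewrite ltr_wpDl.
have k1 : 0 <= k%:R^-1 :> R by rewrite invr_ge0.
have g0 := ltW g_gt0; have g1 := ltW g_lt1.
have N0 : 0 <= sampling_noise w Q by exact: bigmax_ge_id.
rewrite mulrC -ler_pdivlMr //; apply: supnorm_le => [|s a].
  rewrite divr_ge0 ?(ltW n1) // addr_ge0 ?supnorm_ge0 // mulr_ge0 // addr_ge0 //.
    by rewrite mulr_ge0 ?supnorm_ge0.
  by rewrite mulr_ge0.
rewrite ler_pdivlMr // -[n%:R + 1](gtr0_norm n1) -normrM.
set v := vmax a0 Q; set pv := \sum_t p s a t * v t.
set pvs := \sum_t p s a t * vmax a0 Qstar t.
set Y := \sum_(i < k) sampling_deviation Q (s, a) (w (s, a) i).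
have YE : k%:R^-1 * Y = k%:R^-1 * (\sum_(i < k) v (w (s, a) i)) - pv.
  rewrite /Y /sampling_deviation sumrB mulrBr sumr_const card_ord -/v -/pv.
  by rewrite -[pv *+ k]mulr_natl mulKf // pnatr_eq0 -lt0n.
have -> : (alg_step a0 r gamma Q0 n w Q s a - Qstar s a) * (n%:R + 1) =
    (Q0 s a - Qstar s a) + n%:R * (gamma * (pv - pvs) + gamma * (k%:R^-1 * Y)).
  rewrite YE /alg_step /emp_bellman -/v.
  (* Eliminating the reward through the fixed-point equation leaves a difference of two expectations
     plus noise. *)
  have -> : r s a = Qstar s a - gamma * pvs by rewrite {1}Qstar_fix bellmanE -/pvs; ring.
  by field; rewrite pnatr_eq0 -lt0n k0 lt0r_neq0.
have hv : `|pv - pvs| <= dist Q.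
  rewrite /pv /pvs -sumrB; under eq_bigr do rewrite -mulrBr.
  apply: norm_mean_le => // t; apply: vmax_dist_le => a'.
  exact: (le_supnorm (fun s a => Q s a - Qstar s a)).
have hY : `|Y| <= sampling_noise w Q.
  exact: (le_bigmax 0 (fun sa => `|\sum_(i < k) sampling_deviation Q sa (w sa i)|) (s, a)).
rewrite (le_trans (ler_normD _ _)) // lerD //.
  exact: (le_supnorm (fun s a => Q0 s a - Qstar s a)).
rewrite normrM ger0_norm // ler_wpM2l // (le_trans (ler_normD _ _)) // lerD //.
  by rewrite normrM ger0_norm // ler_wpM2l.
(* The factor [gamma] in front of the noise is bounded by 1. *)
rewrite !normrM (ger0_norm g0) (ger0_norm k1) -[leRHS]mul1r.
by apply: ler_pM ; rewrite ?mulr_ge0 ?ler_wpM2l.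
Qed.

Lemma sprob_ge0 k (w : samples S A k) : 0 <= sprob p w.
Proof. by apply: (samples_prob_ge0 (p := fun sa => p sa.1 sa.2)) => j s; exact: p0. Qed.

Lemma sprob_sum1 k : \sum_(w : samples S A k) sprob p w = 1.
Proof. by apply: (@samples_prob_sum1 R _ S k (fun sa => p sa.1 sa.2)). Qed.

(** * Expected noise and the error recursion *)

Variable L : R.
Hypotheses (L1 : 1 <= L) (cardL : 2 * #|{: S * A}|%:R <= expR (2 * L)).
Hypothesis D_gt0 : 0 < D.

(** Deviations are centred differences of two numbers in [[-D, D]], so the maximal inequality
    applies with [B = 2 * D]. *)
Lemma expected_noise_le k Q : (0 < k)%N -> supnorm Q <= D ->
  \sum_(w : samples S A k) sprob p w * sampling_noise w Q
    <= 16 * D * Num.sqrt k%:R * L.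
Proof.
move=> k0 QD.
have vD t : `|vmax a0 Q t| <= D.
  by apply: norm_vmax_le => a'; exact: le_trans (le_supnorm _ _ _) QD.
have -> : 16 * D = 8 * (2 * D) by ring.
apply: (@maximal_inequality R _ S k (fun sa => p sa.1 sa.2)) => //.
- by rewrite mulr_gt0.
- move=> [s a] /=; rewrite /sampling_deviation.
  under eq_bigr do rewrite mulrBr.
  by rewrite sumrB /= -mulr_suml p1 mul1r subrr.
- move=> [s a] s'; rewrite /sampling_deviation (le_trans (ler_normB _ _)) //=.
  have : `|\sum_t p s a t * vmax a0 Q t| <= D by exact: norm_mean_le.
  have := vD s'; lra.
Qed.

(** Step [n] contributes at most [d ^+ (N - n) * G] to the scaled final error, where [G] collects
    the anchor error and the noise. *)
Let d : R := Num.sqrt gamma.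
Let G : R := dist Q0 + 16 * D * L.

(* The choice [k_n >= n^2 gamma^(N-n)] balances the amplification factor [n] of the
   noise of step [n] against its remaining contraction [gamma^(N-n)]. *)
Lemma discounted_noise_le N n Q : (0 < n <= N)%N -> supnorm Q <= D ->
  gamma ^+ (N - n) * (n%:R * ((kn gamma N n)%:R^-1 *
    \sum_(w : samples S A (kn gamma N n)) sprob p w * sampling_noise w Q))
  <= d ^+ (N - n) * (16 * D * L).
Proof.
move=> /andP[n0 nN] QD; have k0 := kn_gt0 g_gt0 N n0.
have /andP[kn_ge _] := kn_bounds g_gt0 N n.
set k := kn gamma N n in k0 kn_ge *; set q : R := Num.sqrt k%:R.
have g0 := ltW g_gt0.
have q0 : 0 < q by rewrite sqrtr_gt0 ltr0n.
have q2 : q ^+ 2 = k%:R by rewrite sqr_sqrtr.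
have d0 : 0 <= d by exact: sqrtr_ge0.
have d2 : d ^+ 2 = gamma by rewrite sqr_sqrtr.
set m := (N - n)%N in kn_ge *.
have dm0 : 0 <= d ^+ m by exact: exprn_ge0.
have gm : gamma ^+ m = d ^+ m * d ^+ m by rewrite -d2 -exprM mulnC exprM expr2.
(* Square root of the lower bound on [k_n]. *)
have nq : n%:R * d ^+ m <= q.
  rewrite -(ler_pXn2r (n := 2)) ?nnegrE ?mulr_ge0 ?(ltW q0) //.
  by rewrite q2 exprMn expr2 -expr2 [X in _ * X]expr2 -gm.
have EN := expected_noise_le k0 QD.
have h : k%:R^-1 * (\sum_(w : samples S A k) sprob p w * sampling_noise w Q)
    <= 16 * D * L / q.
  rewrite ler_pdivrMl ?ltr0n // (le_trans EN) // -/q -q2.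
  rewrite (_ : _ * L = q ^+ 2 * (16 * D * L / q)) //.
  by field; rewrite lt0r_neq0.
have DL : 0 <= 16 * D * L.
  apply: mulr_ge0; last exact: le_trans ler01 L1.
  by apply: mulr_ge0 => //; exact: ltW.
(* One factor [d ^+ m] combines with [n] to cancel [1 / q]; the other survives. *)
rewrite gm -mulrA ler_wpM2l // [d ^+ m * (n%:R * _)]mulrA [d ^+ m * n%:R]mulrC.
apply: (le_trans (ler_wpM2l _ h)); first by rewrite mulr_ge0.
by rewrite mulrCA -[leRHS]mulr1 ler_wpM2l // ler_pdivrMr // mul1r.
Qed.

(** Induction on the number [m] of remaining steps, for every [Q] within [D] since the iterate is
    random. The weight of [Q], which is iterate [n - 1], is [n]; the last quotient is the sum of
    [d ^+ i] for [i < m]. *)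
Lemma exp_err_le N m n Q : (0 < n)%N -> (n + m = N.+1)%N -> supnorm Q <= D ->
  N.+1%:R * exp_err a0 p r gamma N Qstar Q0 m n Q <=
  gamma ^+ m * (n%:R * dist Q) + G * ((1 - d ^+ m) / (1 - d)).
Proof.
have g0 := ltW g_gt0.
have d0 : 0 <= d by exact: sqrtr_ge0.
have d2 : d ^+ 2 = gamma by rewrite sqr_sqrtr.
have d1 : d < 1 by rewrite /d -sqrtr1 ltr_sqrt.
have gd : gamma <= d by rewrite -d2 expr2 -[leRHS]mulr1 ler_wpM2l // ltW.
elim: m n Q => [|m IH] n Q n0 nmN QD.
  by rewrite addn0 in nmN; rewrite /= !expr0 subrr mul0r mulr0 addr0 mul1r nmN.
have mE : m = (N - n)%N by rewrite -subSS -nmN addnS subSS addKn.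
have nN : (0 < n <= N)%N by rewrite n0 -ltnS -nmN -addn1 leq_add2l.
rewrite /=; set k := kn gamma N n.
have k0 : (0 < k)%N by exact: kn_gt0.
pose E := \sum_(w : samples S A k) sprob p w * sampling_noise w Q.
apply: (@le_trans _ _ (gamma ^+ m *
   (dist Q0 + n%:R * (gamma * dist Q + k%:R^-1 * E)) + G * ((1 - d ^+ m) / (1 - d)))).
  set H := G * _; rewrite mulr_sumr.
  (* As the probabilities sum to 1, the bound moves under the expectation, to be compared sample by
     sample. *)
  have -> : gamma ^+ m * (dist Q0 + n%:R * (gamma * dist Q + k%:R^-1 * E)) + H =
    \sum_(w : samples S A k) sprob p w *
      (gamma ^+ m * (dist Q0 + n%:R * (gamma * dist Q + k%:R^-1 * sampling_noise w Q)) + H).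
    pose a := gamma ^+ m * (dist Q0 + n%:R * (gamma * dist Q)) + H.
    pose b := gamma ^+ m * n%:R * k%:R^-1.
    transitivity (\sum_(w : samples S A k)
       (sprob p w * a + b * (sprob p w * sampling_noise w Q))).
      rewrite big_split /= -mulr_suml sprob_sum1 -mulr_sumr -/E /a /b; ring.
    by apply: eq_bigr => w _; rewrite /a /b; ring.
  apply: ler_sum => w _; rewrite mulrCA ler_wpM2l ?sprob_ge0 //.
  apply: (le_trans (IH _ _ _ _ _)) => //; first by rewrite addSnnS.
    exact: alg_step_supnorm_le.
  rewrite lerD2r ler_wpM2l ?exprn_ge0 // -natr1.
  exact: alg_step_dist_le.
have hn := discounted_noise_le nN QD; rewrite -mE -/k -/E in hn.
have hd : gamma ^+ m * dist Q0 <= d ^+ m * dist Q0.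
  by rewrite ler_wpM2r ?supnorm_ge0 // lerXn2r ?nnegrE.
have -> : (1 - d ^+ m.+1) / (1 - d) = d ^+ m + (1 - d ^+ m) / (1 - d).
  by rewrite exprS; field; rewrite subr_eq0 eq_sym lt_eqF.
rewrite exprSr; set H := _ / _; rewrite /G; lra.
Qed.

Lemma expected_error_le N :
  N.+1%:R * expected_error a0 p r gamma N Qstar Q0 <= 72 * D * L / (1 - gamma).
Proof.
have g0 := ltW g_gt0; have g1 := ltW g_lt1.
have d0 : 0 <= d by exact: sqrtr_ge0.
have d2 : d ^+ 2 = gamma by rewrite sqr_sqrtr.
have d1 : d < 1 by rewrite /d -sqrtr1 ltr_sqrt.
have D0 := discounted_bound_ge0.
have e0 : 0 <= dist Q0 by exact: supnorm_ge0.
have e0D := dist_le Q0D.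
have DL : D <= D * L by rewrite -[leLHS]mulr1 ler_wpM2l.
apply: (le_trans (@exp_err_le N N 1 Q0 _ _ Q0D)) => //.
rewrite mul1r.
have h1 : gamma ^+ N * dist Q0 <= dist Q0.
  by rewrite -[leRHS]mul1r ler_wpM2r // exprn_ile1.
have dg : 0 < 1 - gamma by rewrite subr_gt0.
(* From [1 - gamma = 1 - d ^+ 2 <= 2 * (1 - d)]. *)
have hd : (1 - d ^+ N) / (1 - d) <= 2 / (1 - gamma).
  have dN : 0 <= d ^+ N by exact: exprn_ge0.
  rewrite ler_pdivrMr ?subr_gt0 // mulrAC ler_pdivlMr // -d2.
  have : 0 <= d ^+ N * (1 - d ^+ 2) by rewrite mulr_ge0 // d2 ltW.
  have := sqr_ge0 (1 - d); lra.
have G0 : 0 <= G by rewrite /G; lra.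
have h2 := ler_wpM2l G0 hd.
have h3 : G <= G / (1 - gamma).
  by rewrite ler_pdivlMr // -[leRHS]mulr1 ler_wpM2l //; lra.
(* [dist Q0 <= 2 * D] gives [G <= 18 * (D * L)]; the total is at most [3 * G / (1 - gamma)], within
   the constant 72. *)
have h4 : G / (1 - gamma) <= 18 * (D * L) / (1 - gamma).
  by rewrite ler_wpM2r ?invr_ge0 ?(ltW dg) // /G; lra.
have h5 : dist Q0 <= G by rewrite /G; lra.
move: h1 h2 h3 h4 h5; lra.
Qed.

End HalpernIteration.

(** * Choice of the number of iterations and the final bound *)

Theorem theorem6 :
  exists C c : nat,
  forall (R : realType) (S A : finType) (a0 : A)
         (p : S -> A -> S -> R) (r : S -> A -> R) (gamma : R)
         (Qstar Q0 : S -> A -> R) (eps : R),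
    (forall s a s', 0 <= p s a s') ->
    (forall s a, \sum_(s' : S) p s a s' = 1) ->
    (forall s a, 0 <= r s a <= 1) ->
    0 < gamma < 1 ->
    (forall s a, Qstar s a = bellman a0 p r gamma Qstar s a) ->
    supnorm Q0 <= rmax r / (1 - gamma) ->
    0 < eps ->
    exists N : nat,
      expected_error a0 p r gamma N Qstar Q0 <= eps /\
      (num_queries S A gamma N)%:R
        <= C%:R * (#|{: S * A}|%:R * rmax r ^+ 2
                   / (eps ^+ 2 * (1 - gamma) ^+ 5))
           * (ln (3 + #|{: S * A}|%:R + (1 - gamma)^-1 + eps^-1)) ^+ c.
Proof.
(* The query bound is [2 * x ^+ 2 / (1 - gamma)] per pair, with [x] below carrying the factors 72
   and [L]. *)
exists (2 * 72 ^ 2)%N, 2%N.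
move=> R S A a0 p r gamma Qstar Q0 eps p0 p1 r01 /andP[g0 g1] Qfix Q0D eps0.
have r0 s a : 0 <= r s a by case/andP: (r01 s a).
have dg : 0 < 1 - gamma by rewrite subr_gt0.
set T := 3 + _ + _ + _; set m := #|{: S * A}| in T *.
(* [4] dominates [expR 1], so that [ln T] is at least 1. *)
have T4 : 4 <= T.
  have m0 : 0 <= m%:R :> R by [].
  have : 0 < eps^-1 by rewrite invr_gt0.
  have : 1 <= (1 - gamma)^-1 by rewrite invf_ge1 //; lra.
  rewrite /T; lra.
have Tm : m%:R <= T.
  have : 0 < eps^-1 by rewrite invr_gt0.
  have : 0 < (1 - gamma)^-1 by rewrite invr_gt0.
  rewrite /T; lra.
have T0 : 0 < T by lra.
pose L := ln T.
have eL : expR L = T by rewrite lnK.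
have L1 : 1 <= L by rewrite -ler_expR eL (le_trans (expR1_le4 R)).
have cardL : 2 * m%:R <= expR (2 * L).
  rewrite (_ : 2 * L = L + L); last by ring.
  rewrite expRD eL; nra.
(* If [rmax r = 0] then [D = 0], so [Q0] is already exact and [N = 0] works; otherwise [D > 0], as
   the noise bound requires. *)
have [rm0|rmN0] := eqVneq (rmax r) 0.
  exists 0%N; split; last first.
    by rewrite /num_queries big_nil rm0 expr0n /= mulr0 mul0r mulr0 mul0r.
  have := dist_le p0 p1 r0 g0 g1 Qfix Q0D; rewrite rm0 mul0r mulr0 => h.
  exact: le_trans h (ltW eps0).
have rm_gt0 : 0 < rmax r by rewrite lt0r rmN0 rmax_ge0.
have D0 : 0 < rmax r / (1 - gamma) by rewrite divr_gt0.
(* Chosen so that the bound on the scaled error equals [x * eps]. With [N] the integer part of [x],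
   [x < N + 1] yields the accuracy and [N <= x] the query count. *)
pose x := 72 * rmax r * L / (eps * (1 - gamma) ^+ 2).
have x0 : 0 <= x.
  rewrite divr_ge0 ?mulr_ge0 ?exprn_ge0 ?(ltW eps0) ?(ltW dg) ?(ltW rm_gt0) //.
  exact: le_trans ler01 L1.
have /andP[Nx xN] := truncn_itv x0.
set N := Num.trunc x in Nx xN; exists N; split.
  have N0 : 0 < N.+1%:R :> R by rewrite ltr0n.
  rewrite -(ler_pM2l N0).
  apply: (le_trans (expected_error_le p0 p1 r0 g0 g1 Qfix Q0D L1 cardL D0 N)).
  have -> : 72 * (rmax r / (1 - gamma)) * L / (1 - gamma) = x * eps.
    by rewrite /x; field; rewrite !lt0r_neq0.
  by rewrite ler_pM2r // ltW.
apply: (le_trans (num_queries_le g0 g1 S A N)); rewrite -/m.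
have -> : (2 * 72 ^ 2)%N%:R * (m%:R * rmax r ^+ 2 / (eps ^+ 2 * (1 - gamma) ^+ 5)) * L ^+ 2
   = m%:R * (2 * x ^+ 2 / (1 - gamma)).
  by rewrite natrM natrX /x; field; rewrite !lt0r_neq0.
rewrite ler_wpM2l // ler_wpM2r ?invr_ge0 ?(ltW dg) // ler_wpM2l //.
by rewrite lerXn2r ?nnegrE.
Qed.
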